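(* Let $\mathbb{F}$ be a non-archimedean real closed field of finite rank extending $\mathbb{R}$, with a surjective real valuation $\bar v:\mathbb{F}^*\to\mathbb{R}$ whose valuation ring is convex, and let $\tau=-\bar v$. Let $A\in GL_{n+1}(\mathbb{F})$, and let $l(A)=\inf_{x\in FP^n(\mathbb{F})}d(x,Ax)$ be the translation length of $A$ with respect to its action on $FP^n(\mathbb{F})$. Let $\lambda_1,\dots,\lambda_{n+1}\in\mathbb{K}=\mathbb{F}[i]$ be the eigenvalues of $A$, ordered so that $|\lambda_i|\ge|\lambda_{i+1}|$. Then the infimum in the definition of $l(A)$ is a minimum, and $$l(A)=\tau\left(\left|\frac{\lambda_1}{\lambda_{n+1}}\right|\right).$$
   Context: ''Finite rank'' is meant in the sense of ordered fields: the value group of the natural valuation of $\mathbb{F}$ has finitely many convex subgroups. $\mathbb{K}=\mathbb{F}[i]$ ($i^2=-1$) is algebraically closed; $|\cdot|:\mathbb{K}\to\mathbb{F}_{\ge0}$ is $|a+bi|=\sqrt{a^2+b^2}$. Eigenvalues are listed with multiplicity. Let $\mathcal{O}=\{z\in\mathbb{F}:\tau(z)\le0\}$ be the valuation ring ($\tau(0)=-\infty$). A maximal $\mathcal{O}$-lattice of $\mathbb{F}^{n+1}$ is a finitely generated $\mathcal{O}$-submodule of rank $n+1$ (equivalently, a free $\mathcal{O}$-module spanned by an $\mathbb{F}$-basis of $\mathbb{F}^{n+1}$). $FP^n(\mathbb{F})$ is the set of maximal $\mathcal{O}$-lattices modulo $L\sim zL$, $z\in\mathbb{F}^*$; $GL_{n+1}(\mathbb{F})$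 acts on it by $L\mapsto A(L)$. The canonical metric $d$ on $FP^n(\mathbb{F})$ is: for $x,y$ with lifts $L,L'$, choose an $\mathcal{O}$-basis $v_1,\dots,v_{n+1}$ of $L$ and scalars $a_i\in\mathbb{F}^*$ such that $a_1v_1,\dots,a_{n+1}v_{n+1}$ is an $\mathcal{O}$-basis of $L'$ (this is always possible); then $d(x,y)=\max_i\tau(a_i)-\min_i\tau(a_i)$ (independent of choices). *)

(* Defs.v *)
From mathcomp Require Import all_boot all_order all_algebra.
From mathcomp Require Import boolp classical_sets cardinality reals.
From mathcomp Require Import complex.

Set Implicit Arguments.
Unset Strict Implicit.
Unset Printing Implicit Defensive.

Import Order.TTheory GRing.Theory Num.Theory.
Local Open Scope classical_set_scope.
Local Open Scope ring_scope.

(* [nat_le x y] says w(x) <= w(y) for the natural valuation w, whose valuation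
   ring consists of the elements bounded by an integer: y / x is such an
   element.  Large elements have small valuation. *)
Definition nat_le (F : realFieldType) (x y : F) : Prop :=
  exists k : nat, `|y| <= k%:R * `|x|.

(* For x != 0, the value w(x) is the coset of x in F^* / U, where U is the group
   of units of that ring, that is, the archimedean class of x. *)
Definition nat_val (F : realFieldType) (x : F) : set F :=
  [set y | [/\ y != 0, nat_le x y & nat_le y x]].

Definition nat_value_group (F : realFieldType) : set (set F) :=
  [set nat_val x | x in [set x : F | x != 0]].
Arguments nat_value_group : clear implicits.

(* The group law of the value group is w(x) + w(y) = w(x * y). *)
Record nat_convex_subgroup (F : realFieldType) (H : set (set F)) : Prop := {
  nat_convex_sub : H `<=` nat_value_group F;
  nat_convex0 : H (nat_val 1);
  nat_convexB : forall x y : F, x != 0 -> y != 0 ->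
    H (nat_val x) -> H (nat_val y) -> H (nat_val (x / y));
  nat_convex_le : forall x y z : F, x != 0 -> y != 0 -> z != 0 ->
    nat_le x y -> nat_le y z ->
    H (nat_val x) -> H (nat_val z) -> H (nat_val y) }.

Definition finite_rank (F : realFieldType) : Prop :=
  finite_set [set H : set (set F) | nat_convex_subgroup H].

(* A valuation is defined on F^* only: v 0 is a junk value, and no definition
   below depends on it. *)
Record real_valuation (R : realType) (F : realFieldType) (v : F -> R) : Prop := {
  real_valuationM : forall x y : F, x != 0 -> y != 0 -> v (x * y) = v x + v y;
  real_valuationD : forall x y : F, x != 0 -> y != 0 -> x + y != 0 ->
    Num.min (v x) (v y) <= v (x + y) }.

Definition tau (R : realType) (F : realFieldType) (v : F -> R) (z : F) : R :=
  - v z.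

(* The disjunct z = 0 renders the convention tau(0) = -oo. *)
Definition val_ring (R : realType) (F : realFieldType) (v : F -> R) : set F :=
  [set z | z = 0 \/ tau v z <= 0].

Definition convex_set_in (F : realFieldType) (E : set F) : Prop :=
  forall x y z : F, E x -> E z -> x <= y -> y <= z -> E y.

Section Lattices.
Context (R : realType) (F : realFieldType) (v : F -> R) (n : nat).
Local Notation V := 'cV[F]_n.+1.

Definition Ospan (m : nat) (w : 'I_m -> V) : set V :=
  [set \sum_(i < m) c i *: w i |
     c in [set c : 'I_m -> F | forall i, val_ring v (c i)]].

(* The rank of an O-submodule is the dimension of its F-span. *)
Definition maximal_lattice (L : set V) : Prop :=
  exists m (w : 'I_m -> V), L = Ospan w /\ \dim <<codom w>>%VS = n.+1.

Definition Obasis (L : set V) (b : 'I_n.+1 -> V) : Prop :=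
  L = Ospan b /\
  forall c : 'I_n.+1 -> F, (forall i, val_ring v (c i)) ->
    \sum_i c i *: b i = 0 -> forall i, c i = 0.

Definition homothety_class (L : set V) : set (set V) :=
  [set [set z *: x | x in L] | z in [set z : F | z != 0]].

(* Points are classes of maximal lattices, so [x L] says that L is a lift of x. *)
Definition FP : set (set (set V)) :=
  [set homothety_class L | L in [set L | maximal_lattice L]].

Definition FP_act (A : 'M[F]_n.+1) (x : set (set V)) : set (set V) :=
  [set [set A *m u | u in L] | L in x].

(* [FP_dist_value x y r] : r is the value computed from some choice of lifts,
   adapted bases and scalars.  This value does not depend on the choices, and
   [FP_dist] selects it. *)
Definition FP_dist_value (x y : set (set V)) (r : R) : Prop :=
  exists (L L' : set V) (b : 'I_n.+1 -> V) (a : 'I_n.+1 -> F),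
    [/\ x L /\ y L', forall i, a i != 0,
        Obasis L b, Obasis L' (fun i => a i *: b i) &
        r = \big[Num.max/tau v (a ord0)]_(i < n.+1) tau v (a i)
            - \big[Num.min/tau v (a ord0)]_(i < n.+1) tau v (a i)].

Definition FP_dist (x y : set (set V)) : R :=
  xget 0 [set r | FP_dist_value x y r].

Definition translation_length (A : 'M[F]_n.+1) : R :=
  inf [set FP_dist x (FP_act A x) | x in FP].

End Lattices.

Arguments FP {R F} v n _.

(* Main.v *)
(* For a lattice L with an O-basis B such that the a_i b_i form an O-basis of
   A L, the matrix of A in B is D U and that of its inverse is W D^-1, with
   D = diag(a_i) and U, W integral.  An eigenvector over F[i], read at a
   coordinate of largest absolute value, then gives
   tau |lambda| <= max tau(a_i) and tau |lambda^-1| <= - min tau(a_i) for every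
   eigenvalue lambda, hence the lower bound.
   Equality holds as soon as A / c and d A^-1 preserve L, where c and d are the
   largest and the smallest |lambda_i|.  Over F[i] put
   E_k = d^-k (A - lambda_0) ... (A - lambda_(k-1)), so that E_0 = 1, and
   E_(n+1) = 0 by Cayley-Hamilton.  The relation
   A E_k = d E_(k+1) + lambda_k E_k shows, by descending induction on k for
   A^-1, that both operators preserve the module generated over the integral
   elements of F[i] by the columns of all E_k, and L is its real part.
   The convexity of O enters through |x| <= 1 -> O x: maximal minors and maximal
   pivots have integral quotients, which gives bases and adapted bases. *)

Require Import Defs.
From mathcomp Require Import all_boot all_order all_algebra.
From mathcomp Require Import boolp classical_sets cardinality reals.
From mathcomp Require Import fingroup perm complex.

Set Implicit Arguments.
Unset Strict Implicit.
Unset Printing Implicit Defensive.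

Import Order.TTheory GRing.Theory Num.Theory.
Local Open Scope classical_set_scope.
Local Open Scope ring_scope.

(** * Matrices and lattices over a convex subring *)

(** Containing the interval [-1, 1] supplies 0, 1 and -1, and with products it makes [O] convex.
    These closure properties carry the matrix arguments without mention of a valuation. *)
Record convex_subring (F : realFieldType) (O : set F) : Prop := {
  convex_subring_le1 : forall x, `|x| <= 1 -> O x;
  convex_subringD : forall x y, O x -> O y -> O (x + y);
  convex_subringM : forall x y, O x -> O y -> O (x * y) }.

Section ConvexSubring.
Context (F : realFieldType) (O : set F) (O_ring : convex_subring O).

Lemma convex_subring0 : O 0.
Proof. by apply: convex_subring_le1 => //; rewrite normr0. Qed.

Lemma convex_subring1 : O 1.
Proof. by apply: convex_subring_le1 => //; rewrite normr1. Qed.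

Lemma convex_subringN x : O x -> O (- x).
Proof.
move=> Ox; rewrite -mulN1r; apply: convex_subringM => //.
by apply: convex_subring_le1 => //; rewrite normrN1.
Qed.

Lemma convex_subring_sum (I : Type) (s : seq I) (P : pred I) (f : I -> F) :
  (forall i, P i -> O (f i)) -> O (\sum_(i <- s | P i) f i).
Proof.
move=> Of; elim/big_ind: _ => //; first exact: convex_subring0.
exact: convex_subringD.
Qed.

Lemma convex_subring_norm x : O x -> O `|x|.
Proof. by move=> Ox; case: (ger0P x) => _ //; exact: convex_subringN. Qed.

Lemma convex_subring_div x y : `|x| <= `|y| -> O (x / y).
Proof.
have [->|y0] := eqVneq y 0; first by rewrite invr0 mulr0 => _; exact: convex_subring0.
move=> xy; apply: convex_subring_le1 => //.
by rewrite normrM normfV ler_pdivrMr ?normr_gt0 // mul1r.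
Qed.

Lemma convex_subring_le x y : O y -> `|x| <= `|y| -> O x.
Proof.
move=> Oy xy; have [y0|y0] := eqVneq y 0.
  by move: xy; rewrite y0 normr0 normr_le0 => /eqP ->; exact: convex_subring0.
by rewrite -(mulfVK y0 x); apply: convex_subringM => //; exact: convex_subring_div.
Qed.

Definition intmx m n (M : 'M[F]_(m, n)) := forall i j, O (M i j).

Lemma intmx1 n : intmx (1%:M : 'M_n).
Proof.
move=> i j; rewrite mxE; case: eqP => _; first exact: convex_subring1.
exact: convex_subring0.
Qed.

Lemma intmx_delta m n i j : intmx (delta_mx i j : 'M_(m, n)).
Proof.
move=> k l; rewrite mxE; case: (_ && _); first exact: convex_subring1.
exact: convex_subring0.
Qed.

Lemma intmx_mul m n p (M : 'M_(m, n)) (N : 'M_(n, p)) :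
  intmx M -> intmx N -> intmx (M *m N).
Proof.
move=> OMx ON i j; rewrite mxE; apply: convex_subring_sum => k _.
exact: convex_subringM.
Qed.

Definition lattice_of m n (B : 'M[F]_(n, m)) : set 'cV[F]_n :=
  [set B *m c | c in @intmx m 1].

Lemma lattice_of_mul m n p (B : 'M[F]_(n, m)) (P : 'M[F]_(m, p)) :
  intmx P -> lattice_of (B *m P) `<=` lattice_of B.
Proof.
move=> OP _ [c Oc <-]; exists (P *m c); first exact: intmx_mul.
by rewrite mulmxA.
Qed.

Lemma lattice_of_mul_unimodular m n (B : 'M[F]_(n, m)) (P P' : 'M[F]_m) :
  intmx P -> intmx P' -> P *m P' = 1%:M ->
  lattice_of (B *m P) = lattice_of B.
Proof.
move=> OP OP' PP'; rewrite eqEsubset; split; first exact: lattice_of_mul.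
by rewrite -{1}(mulmx1 B) -PP' mulmxA; exact: lattice_of_mul.
Qed.

(** Coefficient vectors chosen column by column assemble into one integral matrix, so an inclusion
    of column modules becomes a factorization. *)
Lemma lattice_of_sub_col m n p (B : 'M[F]_(n, m)) (C : 'M[F]_(n, p)) :
  (forall j, lattice_of B (col j C)) ->
  exists2 P, intmx P & C = B *m P.
Proof.
move=> BC; have /choice [P HP] j : exists c, @intmx m 1 c /\ B *m c = col j C.
  by have [c Oc cE] := BC j; exists c.
exists (\matrix_(i, j) P j i 0).
  by move=> i j; rewrite mxE; have [+ _] := HP j; exact.
apply/matrixP => i j; have [_ /matrixP/(_ i 0)] := HP j.
by rewrite !mxE => <-; apply: eq_bigr => k _; rewrite !mxE.
Qed.

(* Cramer's rule expresses the other columns in the chosen ones by ratios of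
   maximal minors, which the choice makes at most 1 in absolute value. *)
Lemma lattice_of_basis m n (W : 'M[F]_(n, m)) : row_free W ->
  exists2 B : 'M[F]_n, B \in unitmx & lattice_of W = lattice_of B.
Proof.
move=> freeW; have fullW : row_full W^T by rewrite /row_full mxrank_tr.
(* Columns are selected by arbitrary functions, so that one of them can be replaced without keeping
   the indices ordered or distinct. *)
pose minor (f : {ffun 'I_n -> 'I_m}) := \det (colsub f W).
pose f0 : {ffun 'I_n -> 'I_m} := fullrankfun fullW.
have f0_neq0 : minor f0 != 0.
  rewrite /minor -det_tr -unitfE -unitmxE -row_full_unit.
  by have := fullrowsub_full fullW; congr (row_full _); apply/matrixP => i j; rewrite !mxE.
pose f := [arg max_(g > f0) `|minor g|]%O.
have fmax g : `|minor g| <= `|minor f|.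
  by rewrite /f; case: arg_maxP => //= h _; apply.
have fn0 : minor f != 0 by rewrite -normr_gt0; apply: lt_le_trans (fmax f0); rewrite normr_gt0.
have unitB : colsub f W \in unitmx by rewrite unitmxE unitfE.
exists (colsub f W) => //.
have fE : colsub f W = W *m (colsub f 1%:M).
  apply/matrixP => i j; rewrite !mxE (bigD1 (f j)) //= !mxE eqxx mulr1.
  by rewrite big1 ?addr0 // => k kj; rewrite !mxE (negPf kj) mulr0.
rewrite eqEsubset; split; last first.
  by rewrite fE; apply: lattice_of_mul => i j; rewrite mxE; exact: intmx1.
have WE : W = colsub f W *m (invmx (colsub f W) *m W) by rewrite mulKVmx.
rewrite {1}WE; apply: lattice_of_mul => i j.
rewrite /invmx unitB -scalemxAl mxE mulrC; apply: convex_subring_div.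
(* Replacing the [i]-th chosen column by column [j] of [W] produces Cramer's numerator, by Laplace
   expansion along column [i]. *)
pose g : {ffun 'I_n -> 'I_m} := [ffun k => if k == i then j else f k].
apply: le_trans (fmax g); rewrite le_eqVlt; apply/orP; left; apply/eqP; congr (`|_|).
rewrite /minor (expand_det_col _ i) mxE; apply: eq_bigr => k _.
rewrite !mxE ffunE eqxx mulrC; congr (_ * _).
rewrite /cofactor; congr (_ * \det _); apply/matrixP => a b.
by rewrite !mxE ffunE eq_sym (negPf (neq_lift _ _)).
Qed.

(** * Unimodular matrices and diagonalization over [O] *)

Lemma intmx_block m1 m2 n1 n2 (M11 : 'M[F]_(m1, n1)) (M12 : 'M[F]_(m1, n2))
    (M21 : 'M[F]_(m2, n1)) (M22 : 'M[F]_(m2, n2)) :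
  intmx M11 -> intmx M12 -> intmx M21 -> intmx M22 ->
  intmx (block_mx M11 M12 M21 M22).
Proof.
move=> O11 O12 O21 O22 i j; rewrite mxE.
by case: split_ordP => k _; rewrite mxE; case: split_ordP => l _.
Qed.

Lemma intmx0 m n : intmx (0 : 'M_(m, n)).
Proof. by move=> i j; rewrite mxE; exact: convex_subring0. Qed.

Lemma intmxN m n (M : 'M[F]_(m, n)) : intmx M -> intmx (- M).
Proof. by move=> OM i j; rewrite mxE; exact: convex_subringN. Qed.

(** Invertibility over [O]: for square matrices a right inverse is also a left one. *)
Definition unimodular n (P : 'M[F]_n) :=
  intmx P /\ exists P', intmx P' /\ P *m P' = 1%:M.

Lemma unimodular_mul n (P Q : 'M[F]_n) :
  unimodular P -> unimodular Q -> unimodular (P *m Q).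
Proof.
move=> [OP [P' [OP' PP']]] [OQ [Q' [OQ' QQ']]]; split; first exact: intmx_mul.
exists (Q' *m P'); split; first exact: intmx_mul.
by rewrite mulmxA -(mulmxA P) QQ' mulmx1.
Qed.

Lemma unimodular_tr n (P : 'M[F]_n) : unimodular P -> unimodular P^T.
Proof.
move=> [OP [P' [OP' PP']]]; split; first by move=> i j; rewrite mxE.
exists P'^T; split; first by move=> i j; rewrite mxE.
by rewrite -trmx_mul (mulmx1C PP') trmx1.
Qed.

Lemma unimodular_tperm n (i j : 'I_n) : unimodular (tperm_mx i j).
Proof.
have Op : intmx (tperm_mx i j) by move=> k l; rewrite mxE; exact: intmx1.
by split => //; exists (tperm_mx i j); split => //; rewrite -perm_mxM tperm2 perm_mx1.
Qed.

Lemma unimodular_lower n (w : 'cV[F]_n) : intmx w ->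
  unimodular (block_mx 1%:M 0 w 1%:M : 'M_(1 + n)).
Proof.
move=> Ow; have O1 k : intmx (1%:M : 'M_k) := intmx1 (n := k).
split; first exact: intmx_block (O1 _) (@intmx0 _ _) Ow (O1 _).
exists (block_mx 1%:M 0 (- w) 1%:M); split.
  exact: intmx_block (O1 _) (@intmx0 _ _) (intmxN Ow) (O1 _).
by rewrite mulmx_block !mul1mx !mulmx1 !mulmx0 !mul0mx !addr0 !add0r subrr -scalar_mx_block.
Qed.

Lemma unimodular_lift n (P : 'M[F]_n) : unimodular P ->
  unimodular (block_mx 1%:M 0 0 P : 'M_(1 + n)).
Proof.
move=> [OP [P' [OP' PP']]]; have O1 : intmx (1%:M : 'M_1) := intmx1 (n := 1).
have O0 := @intmx0.
split; first exact: intmx_block.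
exists (block_mx 1%:M 0 0 P'); split; first exact: intmx_block.
by rewrite mulmx_block !mul1mx !mulmx0 !mul0mx !addr0 !add0r PP' -scalar_mx_block.
Qed.

(* Pivoting on an entry of largest absolute value keeps the multipliers of the
   elimination at most 1 in absolute value. *)
Lemma Smith_normal_form n (M : 'M[F]_n) :
  exists P Q : 'M[F]_n, exists d : 'rV[F]_n,
    [/\ unimodular P, unimodular Q & M = P *m diag_mx d *m Q].
Proof.
have unimodular1 k : unimodular (1%:M : 'M_k).
  by split; [exact: intmx1|exists 1%:M; split; [exact: intmx1|exact: mulmx1]].
elim: n M => [|n IHn] M; first by exists 1%:M, 1%:M, 0; split => //; apply/matrixP => -[].
have pivot (M1 : 'M[F]_(1 + n)) : (forall i j, `|M1 i j| <= `|M1 ord0 ord0|) ->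
    M1 ord0 ord0 != 0 -> exists P Q : 'M[F]_(1 + n), exists d : 'rV[F]_(1 + n),
    [/\ unimodular P, unimodular Q & M1 = P *m diag_mx d *m Q].
  set a := M1 ord0 ord0 => M1max a0.
  pose w := a^-1 *: dlsubmx M1; pose u := a^-1 *: ursubmx M1.
  have Odiv x : `|x| <= `|a| -> O (a^-1 * x).
    by rewrite mulrC; exact: convex_subring_div.
  have Ow : intmx w by move=> i j; rewrite !mxE; exact/Odiv/M1max.
  have Ou : intmx u by move=> i j; rewrite !mxE; exact/Odiv/M1max.
  (* The recursion is on the Schur complement of the pivot [a]: [M1] is the lower factor of [w],
     times the block diagonal of [a] and this complement, times the upper factor of [u]. *)
  have [P [Q [d [uP uQ dE]]]] := IHn (drsubmx M1 - a *: (w *m u)).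
  exists (block_mx 1%:M 0 w 1%:M *m block_mx 1%:M 0 0 P).
  exists (block_mx 1%:M 0 0 Q *m block_mx 1%:M u 0 1%:M).
  exists (row_mx a%:M d); split.
  - exact: unimodular_mul (unimodular_lower Ow) (unimodular_lift uP).
  - apply: unimodular_mul (unimodular_lift uQ) _.
    (* The upper factor is the transpose of a lower one. *)
    have Ou' : intmx u^T by move=> i j; rewrite mxE.
    by have := unimodular_tr (unimodular_lower Ou'); rewrite tr_block_mx !trmx1 !trmx0 trmxK.
  - rewrite diag_mx_row -!mulmxA (mulmxA (block_mx _ _ _ P)) (mulmxA _ (block_mx _ _ _ Q)).
    rewrite !mulmx_block !mul1mx !mulmx1 !mulmx0 !mul0mx !addr0 !add0r.
    have aE : diag_mx (a%:M : 'rV_1) = a%:M.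
      by apply/matrixP => i j; rewrite !ord1 !mxE.
    have ulE : ulsubmx M1 = a%:M.
      apply/matrixP => i j; rewrite !ord1 !mxE eqxx mulr1n /a.
      by congr (M1 _ _); exact/val_inj.
    rewrite -dE aE !mul_scalar_mx mul_mx_scalar !mul0mx !addr0 add0r.
    have wE : a *: w = dlsubmx M1 by rewrite scalerA divff // scale1r.
    have uE : a *: u = ursubmx M1 by rewrite scalerA divff // scale1r.
    rewrite wE scalemxAr uE.
    by rewrite addrC subrK -ulE submxK.
pose p := [arg max_(q > (ord0, ord0)) `|M q.1 q.2|]%O.
have pmax i j : `|M i j| <= `|M p.1 p.2|.
  by rewrite /p; case: arg_maxP => //= q _ /(_ (i, j)); apply.
have [Mp0|Mp_neq0] := eqVneq (M p.1 p.2) 0.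
  exists 1%:M, 1%:M, 0; split => //; rewrite mulmx1 mul1mx; apply/matrixP => i j.
  by have := pmax i j; rewrite Mp0 normr0 normr_le0 !mxE mul0rn => /eqP.
(* Two transpositions, each its own inverse, bring the largest entry to the top left corner. *)
pose s := tperm p.1 ord0; pose t := tperm p.2 ord0.
pose M1 : 'M_(1 + n) := xcol p.2 ord0 (xrow p.1 ord0 M).
have M1E i j : M1 i j = M (s i) (t j) by rewrite !mxE.
have M1max i j : `|M1 i j| <= `|M1 ord0 ord0|.
  by rewrite !M1E /s /t !tpermR.
have M1_neq0 : M1 ord0 ord0 != 0 by rewrite M1E /s /t !tpermR.
have [P [Q [d [uP uQ dE]]]] := pivot M1 M1max M1_neq0.
exists (perm_mx s *m P), (Q *m perm_mx t), d; split.
- exact: unimodular_mul (unimodular_tperm _ _) uP.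
- exact: unimodular_mul uQ (unimodular_tperm _ _).
- have -> : M = perm_mx s *m M1 *m perm_mx t.
    rewrite /M1 xcolE xrowE !mulmxA -perm_mxM tperm2 perm_mx1 mul1mx.
    by rewrite -mulmxA -perm_mxM tperm2 perm_mx1 mulmx1.
  by rewrite dE !mulmxA.
Qed.

End ConvexSubring.

(** * Lattices over a convex valuation ring *)

Section Valuation.
Context (R : realType) (F : realFieldType) (v : F -> R).
Context (v_val : real_valuation v) (v_convex : convex_set_in (val_ring v)).
Local Notation O := (val_ring v).

Lemma tauM x y : x != 0 -> y != 0 -> tau v (x * y) = tau v x + tau v y.
Proof. by move=> x0 y0; rewrite /tau real_valuationM // opprD. Qed.

Lemma tau1 : tau v 1 = 0.
Proof. by apply: (addrI (tau v 1)); rewrite -tauM ?oner_neq0 // mulr1 addr0. Qed.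

Lemma tauV x : x != 0 -> tau v x^-1 = - tau v x.
Proof.
by move=> x0; apply/eqP; rewrite -addr_eq0 -tauM ?invr_eq0 // mulVf // tau1.
Qed.

Lemma tau_div x y : x != 0 -> y != 0 -> tau v (x / y) = tau v x - tau v y.
Proof. by move=> x0 y0; rewrite tauM ?invr_eq0 // tauV. Qed.

Lemma tauN1 : tau v (- 1) = 0.
Proof.
have N10 : (- 1 : F) != 0 by rewrite oppr_eq0 oner_neq0.
have : tau v (-1) + tau v (-1) = 0 by rewrite -tauM // mulrNN mulr1 tau1.
by rewrite -mulr2n => /eqP; rewrite mulrn_eq0 => /eqP.
Qed.

Lemma val_ringE x : x != 0 -> O x -> tau v x <= 0.
Proof. by move=> x0 [/eqP|//]; rewrite (negPf x0). Qed.

(** Since [tau] vanishes at 1 and -1, both lie in [O], and convexity adds everything between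
    them. *)
Lemma val_ring_convex_subring : convex_subring O.
Proof.
have O_1 : O 1 by right; rewrite tau1.
have O_N1 : O (-1) by right; rewrite tauN1.
split=> [x|x y Ox Oy|x y Ox Oy].
- by rewrite ler_norml => /andP[x1 x2]; exact: v_convex x1 x2.
- have [->|x0] := eqVneq x 0; first by rewrite add0r.
  have [->|y0] := eqVneq y 0; first by rewrite addr0.
  have [xy0|xy0] := eqVneq (x + y) 0; [by left|right].
  rewrite /tau oppr_le0; apply: le_trans (real_valuationD v_val x0 y0 xy0).
  have := val_ringE x0 Ox; have := val_ringE y0 Oy.
  by rewrite /tau !oppr_le0 le_min => -> ->.
- have [->|x0] := eqVneq x 0; first by rewrite mul0r; left.
  have [->|y0] := eqVneq y 0; first by rewrite mulr0; left.
  by right; rewrite tauM // -(addr0 0) lerD ?val_ringE.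
Qed.

Lemma val_ring_tau_le x y : x != 0 -> y != 0 -> O (x / y) -> tau v x <= tau v y.
Proof.
move=> x0 y0 /val_ringE; rewrite mulf_eq0 invr_eq0 negb_or x0 y0 => /(_ isT).
by rewrite tau_div // subr_le0.
Qed.

Lemma tau_mono x y : x != 0 -> `|x| <= `|y| -> tau v x <= tau v y.
Proof.
move=> x0 xy.
have y0 : y != 0 by rewrite -normr_gt0; apply: lt_le_trans xy; rewrite normr_gt0.
apply: val_ring_tau_le => //.
exact: (convex_subring_div val_ring_convex_subring).
Qed.

Section Bases.
Context (n : nat).
Local Notation V := 'cV[F]_n.+1.

Definition colsmx m (w : 'I_m -> V) : 'M[F]_(n.+1, m) := \matrix_(i, j) w j i 0.

Lemma mul_colsmx m (w : 'I_m -> V) (c : 'cV_m) :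
  colsmx w *m c = \sum_i c i 0 *: w i.
Proof.
apply/matrixP => i j; rewrite !mxE summxE; apply: eq_bigr => k _.
by rewrite !mxE !ord1 mulrC.
Qed.

Lemma colsmx_col m (B : 'M[F]_(n.+1, m)) : colsmx (fun j => col j B) = B.
Proof. by apply/matrixP => i j; rewrite !mxE. Qed.

Lemma colsmxZ m (a : 'I_m -> F) (w : 'I_m -> V) :
  colsmx (fun i => a i *: w i) = colsmx w *m diag_mx (\row_i a i).
Proof. by rewrite mul_mx_diag; apply/matrixP => i j; rewrite !mxE mulrC. Qed.

Lemma OspanE m (w : 'I_m -> V) : Ospan v w = lattice_of O (colsmx w).
Proof.
rewrite eqEsubset; split => _ [c Oc <-].
  exists (\col_i c i); first by move=> i j; rewrite mxE.
  by rewrite mul_colsmx; apply: eq_bigr => i _; rewrite mxE.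
by exists (fun i => c i 0) => //; rewrite mul_colsmx.
Qed.

(** Independence over [O] gives independence over [F]: dividing a relation by its coefficient of
    largest absolute value makes all coefficients integral. *)
Lemma ObasisP (L : set V) (b : 'I_n.+1 -> V) :
  Obasis v L b <-> L = lattice_of O (colsmx b) /\ colsmx b \in unitmx.
Proof.
rewrite /Obasis OspanE; split=> -[LE bU]; split=> //; last first.
  move=> c _ c0 i.
  have : colsmx b *m (\col_i c i) = 0.
    by rewrite -[RHS]c0 mul_colsmx; apply: eq_bigr => j _; rewrite mxE.
  move=> /(congr1 (mulmx (invmx (colsmx b)))); rewrite mulKmx // mulmx0.
  by move=> /matrixP/(_ i 0); rewrite !mxE.
rewrite -unitmx_tr -row_free_unit -kermx_eq0; apply/rowV0P => c /sub_kermxP c0.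
pose p := [arg max_(q > ord0) `|c 0 q|]%O.
have pmax i : `|c 0 i| <= `|c 0 p|.
  by rewrite /p; case: arg_maxP => //= q _ ; apply.
have [cp0|cp0] := eqVneq (c 0 p) 0.
  by apply/rowP => i; have := pmax i; rewrite cp0 normr0 normr_le0 mxE => /eqP.
(* In the rescaled relation the coefficient at [p] equals 1, while [bU] forces it to be 0. *)
suff : c 0 p / c 0 p = 0 by rewrite divff // => /eqP; rewrite oner_eq0.
apply: (bU (fun i => c 0 i / c 0 p)) => [i|].
  exact: (convex_subring_div val_ring_convex_subring).
have : colsmx b *m c^T = 0 by rewrite -[colsmx b]trmxK -trmx_mul c0 trmx0.
rewrite mul_colsmx => /(congr1 ( *:%R (c 0 p)^-1)); rewrite scaler0 => c0'.
by rewrite -[RHS]c0' scaler_sumr; apply: eq_bigr => i _; rewrite scalerA mxE mulrC.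
Qed.

(** Generators span the whole space over [F] exactly when their matrix has a right inverse, whose
    columns express the standard basis in them. *)
Lemma maximal_latticeP (L : set V) : maximal_lattice v L <->
  exists m (W : 'M[F]_(n.+1, m)), row_free W /\ L = lattice_of O W.
Proof.
split=> [[m [w [-> dimw]]]|[m [W [/row_freeP[B WB] ->]]]].
  exists m, (colsmx w); split; last exact: OspanE.
  have wfull : <<codom w>>%VS = fullv.
    by apply/eqP; rewrite eqEdim subvf dimw dimvf /dim /= muln1 leqnn.
  have /choice [c cE] j : exists c : 'cV_m, colsmx w *m c = delta_mx j 0.
    have : delta_mx j 0 \in <<codom w>>%VS by rewrite wfull memvf.
    rewrite span_def big_image => /memv_sumP[u uw ->].
    have /choice [c cE] i : exists c, u i = c *: w i by exact/vlineP/uw.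
    exists (\col_i c i); rewrite mul_colsmx; apply: eq_bigr => i _.
    by rewrite mxE cE.
  apply/row_freeP; exists (\matrix_(i, j) c j i 0); apply/matrixP => i j.
  have /matrixP/(_ i 0) := cE j; rewrite !mxE eqxx andbT => <-.
  by apply: eq_bigr => k _; rewrite !mxE.
exists m, (fun j => col j W); split; first by rewrite OspanE colsmx_col.
suff -> : <<codom (fun j => col j W)>>%VS = fullv by rewrite dimvf /dim /= muln1.
apply/eqP; rewrite eqEsubv subvf; apply/subvP => x _.
rewrite -(mul1mx x) -WB -mulmxA -{1}(colsmx_col W) mul_colsmx.
apply: memv_suml => i _; apply: memvZ; apply: memv_span.
exact: (codom_f (fun j => col j W)).
Qed.

Lemma lattice_of_image m (A : 'M[F]_n.+1) (B : 'M[F]_(n.+1, m)) :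
  [set A *m u | u in lattice_of O B] = lattice_of O (A *m B).
Proof.
rewrite eqEsubset; split => [_ [_ [c Oc <-] <-]|_ [c Oc <-]].
  by exists c => //; rewrite mulmxA.
by exists (B *m c); [exists c|rewrite mulmxA].
Qed.

(** If [A] has matrix [P D Q] in a basis [B], with [P], [Q] unimodular and [D] diagonal, then
    [A B = (B P) D Q]. So [B P] is a basis of [L], and [B P D] one of [A L]. *)
Lemma adapted_basis (A : 'M[F]_n.+1) (L : set V) :
  A \in unitmx -> maximal_lattice v L ->
  exists b a, [/\ forall i, a i != 0, Obasis v L b &
    Obasis v [set A *m u | u in L] (fun i => a i *: b i)].
Proof.
have OR := val_ring_convex_subring.
move=> AU /maximal_latticeP[m [W [Wfree ->]]].
have [B BU ->] := lattice_of_basis OR Wfree.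
have [P [Q [d [uP uQ dE]]]] := Smith_normal_form OR (invmx B *m A *m B).
have unimodular_unit k (X : 'M[F]_k) : unimodular O X -> X \in unitmx.
  by move=> [_ [X' [_ /mulmx1_unit[]]]].
have PU := unimodular_unit _ _ uP; have QU := unimodular_unit _ _ uQ.
have dU : diag_mx d \in unitmx.
  have : invmx B *m A *m B \in unitmx by rewrite !unitmx_mul unitmx_inv BU AU.
  by rewrite dE !unitmx_mul => /andP[/andP[]].
have d0 i : d 0 i != 0.
  by move: dU; rewrite unitmxE det_diag unitfE => /prodf_neq0; apply.
have dE' : \row_i d 0 i = d by apply/rowP => i; rewrite mxE.
exists (fun j => col j (B *m P)), (fun j => d 0 j); split => //.
  apply/ObasisP; rewrite colsmx_col unitmx_mul BU PU; split => //.
  by case: uP => OP [P' [OP' PP']]; rewrite (lattice_of_mul_unimodular OR B OP OP' PP').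
apply/ObasisP; rewrite colsmxZ colsmx_col dE' !unitmx_mul BU PU dU; split => //.
rewrite lattice_of_image.
have -> : A *m B = B *m P *m diag_mx d *m Q.
  by rewrite -!mulmxA (mulmxA P) -dE !mulmxA mulmxV // mul1mx.
by case: uQ => OQ [Q' [OQ' QQ']]; rewrite (lattice_of_mul_unimodular OR _ OQ OQ' QQ').
Qed.

End Bases.
End Valuation.

(** * Complex eigenvalues *)

Section Complexification.
Import ComplexField.Normc.
Context (F : rcfType).
Local Notation toC := (real_complex F).

Lemma normc_real (x : F) : normc (toC x) = `|x|.
Proof. by rewrite /normc /= expr0n addr0 sqrtr_sqr. Qed.

Lemma normc_ge0 (z : F[i]) : 0 <= normc z.
Proof. by case: z => a b; exact: sqrtr_ge0. Qed.

Lemma normc_neq0 (z : F[i]) : z != 0 -> normc z != 0.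
Proof. by apply: contra => /eqP/eq0_normc ->. Qed.

Lemma normc_sum (I : Type) (s : seq I) (f : I -> F[i]) :
  normc (\sum_(i <- s) f i) <= \sum_(i <- s) normc (f i).
Proof.
elim: s => [|i s IHs]; first by rewrite !big_nil normc0.
by rewrite !big_cons; apply: le_trans (le_normcD _ _) _; rewrite lerD2l.
Qed.

Lemma normc_Re_le (z : F[i]) : `|complex.Re z| <= normc z.
Proof.
by case: z => a b /=; rewrite -sqrtr_sqr ler_wsqrtr // lerDl sqr_ge0.
Qed.

Lemma normc_Im_le (z : F[i]) : `|complex.Im z| <= normc z.
Proof.
by case: z => a b /=; rewrite -sqrtr_sqr ler_wsqrtr // lerDr sqr_ge0.
Qed.

Definition Remx m n (M : 'M[F[i]]_(m, n)) : 'M[F]_(m, n) := map_mx (@complex.Re F) M.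

Lemma RemxD m n (M N : 'M[F[i]]_(m, n)) : Remx (M + N) = Remx M + Remx N.
Proof. by apply/matrixP => i j; rewrite !mxE; case: (M i j) (N i j) => [? ?] []. Qed.

Lemma RemxN m n (M : 'M[F[i]]_(m, n)) : Remx (- M) = - Remx M.
Proof. by apply/matrixP => i j; rewrite !mxE; case: (M i j). Qed.

(** Real matrices act separately on real and imaginary parts, which lets stability descend from F[i]
    to [F]. *)
Lemma RemxM m n p (A : 'M[F]_(m, n)) (M : 'M[F[i]]_(n, p)) :
  Remx (map_mx toC A *m M) = A *m Remx M.
Proof.
apply/matrixP => i j; rewrite !mxE.
rewrite (big_morph (@complex.Re F) (id1 := 0) (op1 := +%R)) //; last by move=> [? ?] [].
by apply: eq_bigr => k _; rewrite !mxE; case: (M k j) => a b /=; rewrite mul0r subr0.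
Qed.

Lemma RemxZ m n (a : F) (M : 'M[F[i]]_(m, n)) : Remx (toC a *: M) = a *: Remx M.
Proof.
by apply/matrixP => i j; rewrite !mxE; case: (M i j) => b c /=; rewrite mul0r subr0.
Qed.

Context (O : set F) (O_ring : convex_subring O).

(* At a coordinate where the eigenvector is largest, the eigenvalue equation
   bounds the eigenvalue by the absolute column sum. *)
Lemma eigenvalue_integral n (M : 'M[F]_n.+1) (z : F[i]) :
  intmx O M -> eigenvalue (map_mx toC M) z -> O (normc z).
Proof.
move=> OMx /eigenvalueP[u uM u0].
pose p := [arg max_(q > ord0) normc (u 0 q)]%O.
have pmax i : normc (u 0 i) <= normc (u 0 p).
  by rewrite /p; case: arg_maxP => //= q _ ; apply.
have up0 : 0 < normc (u 0 p).
  rewrite lt_neqAle normc_ge0 andbT eq_sym; apply: contra u0 => /eqP up0.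
  apply/eqP/rowP => i; rewrite mxE; apply/eq0_normc/eqP.
  by rewrite eq_le normc_ge0 andbT -up0.
have Osum : O (\sum_j `|M j p|).
  by apply: (convex_subring_sum O_ring) => j _; apply: convex_subring_norm.
apply: (convex_subring_le O_ring Osum).
rewrite !ger0_norm ?normc_ge0 ?sumr_ge0 //.
rewrite -(ler_pM2r up0) -normcM.
have /matrixP/(_ 0 p) := uM; rewrite !mxE => <-.
apply: le_trans (normc_sum _ _) _; rewrite mulr_suml; apply: ler_sum => j _.
by rewrite mxE normcM normc_real mulrC ler_wpM2l.
Qed.

Lemma eigenvalue_scale n (M : 'M[F]_n.+1) (a : F) (z : F[i]) :
  eigenvalue (map_mx toC M) z -> eigenvalue (map_mx toC (a *: M)) (toC a * z).
Proof.
move=> /eigenvalueP[u uM u0]; apply/eigenvalueP; exists u => //.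
by rewrite map_mxZ -scalemxAr uM scalerA.
Qed.

Lemma eigenvalue_inv n (M : 'M[F]_n.+1) (z : F[i]) : M \in unitmx ->
  eigenvalue (map_mx toC M) z -> z != 0 /\ eigenvalue (map_mx toC (invmx M)) z^-1.
Proof.
move=> MU /eigenvalueP[u uM u0].
have CU : map_mx toC M \in unitmx by rewrite map_unitmx.
have z0 : z != 0.
  apply: contra u0 => /eqP z0; apply/eqP.
  by rewrite -(mulmxK CU u) uM z0 scale0r mul0mx.
split => //; apply/eigenvalueP; exists u => //.
by rewrite map_invmx -{1}(scale1r u) -(mulVf z0) -scalerA -scalemxAl -uM mulmxK.
Qed.

Lemma eigenvalue_conj n (M B : 'M[F]_n.+1) (z : F[i]) : B \in unitmx ->
  eigenvalue (map_mx toC M) z -> eigenvalue (map_mx toC (invmx B *m M *m B)) z.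
Proof.
move=> BU /eigenvalueP[u uM u0].
have CU : map_mx toC B \in unitmx by rewrite map_unitmx.
apply/eigenvalueP; exists (u *m map_mx toC B).
  by rewrite !map_mxM map_invmx !mulmxA mulmxK // uM -scalemxAl.
by apply: contra u0 => /eqP uB; rewrite -(mulmxK CU u) uB mul0mx.
Qed.

End Complexification.

(** * A lattice stable under [A / c] and [d A^-1] *)

Lemma Cayley_Hamilton_chain (F : rcfType) n (C : 'M[F[i]]_n.+1) (d : F[i])
    (lambda : 'I_n.+1 -> F[i]) :
  d != 0 -> char_poly C = \prod_(i < n.+1) ('X - (lambda i)%:P) ->
  exists E : nat -> 'M[F[i]]_n.+1, [/\ E 0%N = 1%:M, E n.+1 = 0 &
    forall k, C *m E k = d *: E k.+1 + lambda (inord k) *: E k].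
Proof.
move=> d0 CE.
(* [inord] gives the index itself up to n and a default beyond, so the recurrence holds for every k.
   At k = n+1 the product is the characteristic polynomial. *)
exists (fun k => d^-1 ^+ k *: horner_mx C (\prod_(i < k) ('X - (lambda (inord i))%:P))).
split=> [||k].
- by rewrite big_ord0 rmorph1 expr0 scale1r.
- rewrite (eq_bigr (fun i => 'X - (lambda i)%:P)) => [|i _]; last by rewrite inord_val.
  by rewrite -CE Cayley_Hamilton scaler0.
- rewrite big_ord_recr /= mulrC rmorphM rmorphB /= horner_mx_X horner_mx_C.
  set H := horner_mx _ _.
  rewrite scalerA exprS mulrA divff // mul1r.
  rewrite -[_ * H]/(_ *m H) mulmxBl mul_scalar_mx scalerBr !scalerA.
  by rewrite [_ * lambda _]mulrC subrK -scalemxAr.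
Qed.

Section InvariantLattice.
Import ComplexField.Normc.
Context (F : rcfType) (O : set F) (O_ring : convex_subring O).
Context (n : nat) (A : 'M[F]_n.+1) (A_unit : A \in unitmx).
Context (lambda : 'I_n.+1 -> F[i]) (c d : F).
Context (E : nat -> 'M[F[i]]_n.+1) (E_0 : E 0%N = 1%:M) (E_last : E n.+1 = 0).
Context (E_rec : forall k, map_mx (real_complex F) A *m E k =
  real_complex F d *: E k.+1 + lambda (inord k) *: E k).
Context (d_gt0 : 0 < d) (lambda_ge : forall i, d <= normc (lambda i)).
Context (lambda_le : forall i, normc (lambda i) <= c).
Local Notation toC := (real_complex F).
Local Notation C := (map_mx toC A).

Local Notation T := ('I_n.+1 * 'I_n.+1 * bool)%type.

(* The O-module generated by these columns is the real part of the module
   spanned over the integral elements of F[i] by the columns of all E_k. *)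
Definition eigcols : 'M[F]_(n.+1, #|{: T}|) :=
  \matrix_(i, q) let: (k, j, b) := (enum_val q : T) in
    Remx ((if b then 'i%C else 1) *: E k) i j.

Definition eigcols_span p (X : 'M[F]_(n.+1, p)) :=
  exists2 P, intmx O P & X = eigcols *m P.

Lemma eigcols_spanD p (X Y : 'M[F]_(n.+1, p)) :
  eigcols_span X -> eigcols_span Y -> eigcols_span (X + Y).
Proof.
move=> [P OP ->] [Q OQ ->]; exists (P + Q); last by rewrite mulmxDr.
by move=> i j; rewrite mxE; apply: convex_subringD.
Qed.

Lemma eigcols_spanZ p a (X : 'M[F]_(n.+1, p)) :
  O a -> eigcols_span X -> eigcols_span (a *: X).
Proof.
move=> Oa [P OP ->]; exists (a *: P); last by rewrite scalemxAr.
by move=> i j; rewrite mxE; apply: convex_subringM.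
Qed.

Lemma eigcols_span_gen (k : 'I_n.+1) (b : bool) :
  eigcols_span (Remx ((if b then 'i%C else 1) *: E k)).
Proof.
apply: lattice_of_sub_col => j; exists (delta_mx (enum_rank (k, j, b)) 0).
  exact: intmx_delta.
by rewrite -colE; apply/matrixP => x y; rewrite [LHS]mxE [LHS]mxE enum_rankK !mxE.
Qed.

(** Split z into real and imaginary parts, both bounded by |z| and hence integral. The index k = n+1
    is allowed because [E_last] makes that term zero. *)
Lemma eigcols_span_Re k z : (k <= n.+1)%N -> O (normc z) ->
  eigcols_span (Remx (z *: E k)).
Proof.
rewrite leq_eqVlt => /predU1P[->|kn] Oz.
  rewrite E_last scaler0; exists 0; first exact: intmx0.
  by rewrite mulmx0; apply/matrixP => i j; rewrite !mxE.
have zE : z *: E k =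
    toC (complex.Re z) *: (1 *: E k) + toC (complex.Im z) *: ('i%C *: E k).
  by rewrite !scalerA -scalerDl mulr1 [toC (complex.Im z) * _]mulrC -complexE.
have absz : normc z = `|normc z| by rewrite ger0_norm ?normc_ge0.
rewrite zE RemxD (RemxZ (complex.Re z)) (RemxZ (complex.Im z)); apply: eigcols_spanD; apply: eigcols_spanZ.
- by apply: convex_subring_le Oz _ => //; rewrite -absz normc_Re_le.
- exact: (eigcols_span_gen (Ordinal kn) false).
- by apply: convex_subring_le Oz _ => //; rewrite -absz normc_Im_le.
- exact: (eigcols_span_gen (Ordinal kn) true).
Qed.

Lemma normc_le1_mul z w : O (normc z) -> normc w <= 1 -> O (normc (z * w)).
Proof.
move=> Oz w1; rewrite normcM; apply: convex_subringM => //.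
by apply: convex_subring_le1 => //; rewrite ger0_norm ?normc_ge0.
Qed.

Lemma c_gt0 : 0 < c.
Proof. exact: lt_le_trans d_gt0 (le_trans (lambda_ge ord0) (lambda_le ord0)). Qed.

(** The recurrence gives [A / c] on z E_k the coefficients z d / c and z lambda_k / c, at most |z|
    in absolute value as d <= c and |lambda_k| <= c. *)
Lemma eigcols_span_mul k z : (k < n.+1)%N -> O (normc z) ->
  eigcols_span (c^-1 *: A *m Remx (z *: E k)).
Proof.
move=> kn Oz; have c0 := c_gt0.
have cV0 : normc (toC c^-1) = c^-1 by rewrite normc_real gtr0_norm ?invr_gt0.
rewrite -RemxM map_mxZ -scalemxAl -scalemxAr E_rec !scalerDr !scalerA RemxD.
apply: eigcols_spanD; apply: eigcols_span_Re => //; try exact: ltnW.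
- rewrite [toC c^-1 * z]mulrC -mulrA; apply: normc_le1_mul => //.
  rewrite normcM cV0 normc_real gtr0_norm // ler_pdivrMl // mulr1.
  exact: le_trans (lambda_ge ord0) (lambda_le ord0).
- rewrite [toC c^-1 * z]mulrC -mulrA; apply: normc_le1_mul => //.
  by rewrite normcM cV0 ler_pdivrMl // mulr1.
Qed.

(** Solving the recurrence gives d A^-1 E_k = (d / lambda_k) (E_k - d A^-1 E_(k+1)), where |d /
    lambda_k| <= 1. *)
Lemma eigcols_span_mul_inv k z : (k <= n.+1)%N -> O (normc z) ->
  eigcols_span (d *: invmx A *m Remx (z *: E k)).
Proof.
(* Descending induction on k is induction on n+1-k, starting from E_(n+1) = 0. The scalar z stays
   general because each step multiplies it by d / lambda_k. *)
move=> kn; rewrite -(subKn kn); elim: (n.+1 - k)%N (leq_subr k n.+1) z => [|m IHm] mn z Oz.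
  rewrite subn0 E_last scaler0; exists 0; first exact: intmx0.
  by rewrite !mulmx0; apply/matrixP => i j; rewrite !mxE big1 // => l _; rewrite !mxE mulr0.
set l := (n.+1 - m.+1)%N; have lE : (n.+1 - m)%N = l.+1 by rewrite /l subSn // -subSn.
have CU : C \in unitmx by rewrite map_unitmx.
set mu := lambda (inord l); have mu_ge : d <= normc mu := lambda_ge _.
have mu0 : mu != 0.
  by apply/eqP => mu0; move: mu_ge; rewrite mu0 normc0 leNgt d_gt0.
have recE : toC d *: (invmx C *m E l) =
    (toC d / mu) *: (E l - toC d *: (invmx C *m E l.+1)).
  have := E_rec l => /(congr1 (mulmx (invmx C))).
  rewrite mulKmx // mulmxDr -!scalemxAr => ElE; rewrite {2}ElE.
  by rewrite [in RHS]addrC addKr scalerA mulfVK.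
have Ow : O (normc (z * (toC d / mu))).
  apply: normc_le1_mul => //.
  rewrite normcM normcV normc_real gtr0_norm // ler_pdivrMr ?mul1r //.
  exact: lt_le_trans mu_ge.
have -> : d *: invmx A *m Remx (z *: E l) =
    Remx ((z * (toC d / mu)) *: E l)
    + (-1) *: (d *: invmx A *m Remx ((z * (toC d / mu)) *: E l.+1)).
  rewrite scaleN1r -!RemxM -RemxN -RemxD map_mxZ map_invmx; congr Remx.
  rewrite -!scalemxAl -!scalemxAr (scalerA (toC d) z) (mulrC (toC d) z).
  rewrite -(scalerA z (toC d)) recE scalerA scalerBr.
  by congr (_ - _); rewrite !scalerA [in RHS]mulrC.
apply: eigcols_spanD; first by apply: eigcols_span_Re => //; exact: leq_subr.
apply: eigcols_spanZ.
  by apply: (convex_subring_le1 O_ring); rewrite normrN1.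
by rewrite -lE; apply: IHm => //; exact: ltnW.
Qed.

(** The columns of [eigcols] come from z = 1 and z = i, both of absolute value 1, so [M] acts on
    these generators by an integral matrix. *)
Lemma eigcols_span_sub (M : 'M[F]_n.+1) :
  (forall k z, (k < n.+1)%N -> O (normc z) -> eigcols_span (M *m Remx (z *: E k))) ->
  forall x, lattice_of O eigcols x -> lattice_of O eigcols (M *m x).
Proof.
move=> OM x [u Ou <-].
have [P OP PE] : eigcols_span (M *m eigcols).
  apply: lattice_of_sub_col => // q; case qE : (enum_val q : T) => [[k j] b].
  have Ob : O (normc (if b then 'i%C else 1 : F[i])).
    apply: (convex_subring_le1 O_ring); rewrite ger0_norm ?normc_ge0 //.
    by case: b {qE}; rewrite /normc /= !expr0n !expr1n ?addr0 ?add0r sqrtr1.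
  have [P OP PE] := OM k _ (ltn_ord k) Ob.
  exists (col j P); first by move=> x' y; rewrite mxE.
  rewrite [col j P]colE mulmxA -PE [col q _]colE -!mulmxA; congr (M *m _).
  by rewrite -!colE; apply/matrixP => x' y; rewrite [RHS]mxE [RHS]mxE qE mxE.
rewrite mulmxA PE -mulmxA; exists (P *m u) => //; exact: intmx_mul.
Qed.

Lemma eigcols_stable : exists m (W : 'M[F]_(n.+1, m)),
  [/\ row_free W,
      forall x, lattice_of O W x -> lattice_of O W (c^-1 *: A *m x) &
      forall x, lattice_of O W x -> lattice_of O W (d *: invmx A *m x)].
Proof.
exists _, eigcols; split.
(* The columns of E_0 = 1 are among the generators, which yields a right inverse. *)
- have [P _ PE] := eigcols_span_gen ord0 false.
  apply/row_freeP; exists P; rewrite -PE E_0 scale1r.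
  by apply/matrixP => i j; rewrite !mxE; case: (i == j).
- by apply: eigcols_span_sub => k z kn Oz; exact: eigcols_span_mul.
- by apply: eigcols_span_sub => k z kn Oz; apply: eigcols_span_mul_inv => //; exact: ltnW.
Qed.

End InvariantLattice.

Lemma invariant_lattice (F : rcfType) (O : set F) n (A : 'M[F]_n.+1)
    (lambda : 'I_n.+1 -> F[i]) (c d : F) :
  convex_subring O -> A \in unitmx ->
  char_poly (map_mx (real_complex F) A) = \prod_(i < n.+1) ('X - (lambda i)%:P) ->
  0 < d -> (forall i, d <= ComplexField.Normc.normc (lambda i) <= c) ->
  exists m (W : 'M[F]_(n.+1, m)),
  [/\ row_free W,
      forall x, lattice_of O W x -> lattice_of O W (c^-1 *: A *m x) &
      forall x, lattice_of O W x -> lattice_of O W (d *: invmx A *m x)].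
Proof.
move=> O_ring A_unit lambda_eigen d_gt0 lambda_bound.
have dC0 : real_complex F d != 0 by rewrite fmorph_eq0 gt_eqF.
have [E [E0 Elast Erec]] := Cayley_Hamilton_chain dC0 lambda_eigen.
by apply: (eigcols_stable O_ring A_unit E0 Elast Erec d_gt0) => i; case/andP: (lambda_bound i).
Qed.

(** * The distance on FP^n *)

Section Distance.
Import ComplexField.Normc.
Context (R : realType) (F : rcfType) (v : F -> R).
Context (v_val : real_valuation v) (v_convex : convex_set_in (val_ring v)).
Local Notation O := (val_ring v).
Local Notation toC := (real_complex F).
Context (n : nat).
Local Notation V := 'cV[F]_n.+1.
Let O_ring := val_ring_convex_subring v_val v_convex.

(** The expression in [FP_dist_value]. The default of both extrema is a term of the family, so it
    alters neither. *)
Definition spread (a : 'I_n.+1 -> F) : R :=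
  \big[Num.max/tau v (a ord0)]_(i < n.+1) tau v (a i)
  - \big[Num.min/tau v (a ord0)]_(i < n.+1) tau v (a i).

Lemma spread_ge (a : 'I_n.+1 -> F) i j : tau v (a i) - tau v (a j) <= spread a.
Proof. by apply: lerB; [exact: le_bigmax|exact: bigmin_le]. Qed.

Lemma spread_le (a : 'I_n.+1 -> F) x y :
  (forall i, tau v (a i) <= x) -> (forall i, y <= tau v (a i)) -> spread a <= x - y.
Proof. by move=> ax ay; apply: lerB; [exact: bigmax_le|exact: le_bigmin]. Qed.

Lemma tau_normr (x : F) : x != 0 -> tau v `|x| = tau v x.
Proof.
by move=> x0; apply/eqP; rewrite eq_le !(tau_mono v_val) ?normr_eq0 ?normr_id.
Qed.

(** The quotient z / c is an eigenvalue of the integral matrix [N], so |z| / |c| is integral. *)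
Lemma tau_eigenvalue_le (M N : 'M[F]_n.+1) (c : F) (z : F[i]) :
  intmx O N -> M = c *: N -> c != 0 -> z != 0 ->
  eigenvalue (map_mx toC M) z -> tau v (normc z) <= tau v c.
Proof.
move=> ON -> c0 z0 /(eigenvalue_scale c^-1).
rewrite scalerA mulVf // scale1r => /(eigenvalue_integral O_ring ON) Oz.
rewrite -(tau_normr c0); apply: val_ring_tau_le => //.
- exact: normc_neq0.
- by rewrite normr_eq0.
- by move: Oz; rewrite normcM normc_real normfV mulrC.
Qed.

(** * Bounds on the spread read from one adapted basis *)

Section AdaptedBasis.
Context (A : 'M[F]_n.+1) (A_unit : A \in unitmx) (L : set V).
Context (b : 'I_n.+1 -> V) (a : 'I_n.+1 -> F) (a_neq0 : forall i, a i != 0).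
Context (Lb : Obasis v L b) (ALb : Obasis v [set A *m u | u in L] (fun i => a i *: b i)).
Let B := colsmx b.
Let D := diag_mx (\row_i a i).

Let LE : L = lattice_of O B.
Proof. by have [/(_ Lb)[]] := ObasisP v_val v_convex L b. Qed.

Let BU : B \in unitmx.
Proof. by have [/(_ Lb)[]] := ObasisP v_val v_convex L b. Qed.

Let ALE : lattice_of O (A *m B) = lattice_of O (B *m D).
Proof.
have [/(_ ALb)[+ _] _] := ObasisP v_val v_convex [set A *m u | u in L] (fun i => a i *: b i).
by rewrite LE lattice_of_image colsmxZ.
Qed.

Lemma spread_ge_eigenvalues (z w : F[i]) :
  eigenvalue (map_mx toC A) z -> eigenvalue (map_mx toC A) w ->
  tau v (normc z) - tau v (normc w) <= spread a.
Proof.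
move=> Az Aw.
have [z0 _] := eigenvalue_inv A_unit Az; have [w0 AVw] := eigenvalue_inv A_unit Aw.
(* This choice makes all [a i / a p] and [a q / a i] integral; [a p] and [(a q)^-1] are the scalars
   extracted below from the matrices of [A] and of its inverse. *)
pose p := [arg max_(q > ord0) `|a q|]%O; pose q := [arg min_(q < ord0) `|a q|]%O.
have pmax i : `|a i| <= `|a p| by rewrite /p; case: arg_maxP => //= k _; apply.
have qmin i : `|a q| <= `|a i| by rewrite /q; case: arg_minP => //= k _; apply.
have Odiv i j : `|a i| <= `|a j| -> O (a i / a j) := @convex_subring_div _ _ O_ring _ _.
have cols_in m (X Y : 'M[F]_(n.+1, m)) : lattice_of O X = lattice_of O Y ->
    exists2 P, intmx O P & X = Y *m P.
  move=> XY; apply: lattice_of_sub_col => // j; rewrite -XY colE.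
  by exists (delta_mx j 0) => //; exact: intmx_delta.
(* The two inclusions between the lattices give A B = B D U and B D = A B W. *)
have [U OU UE] := cols_in _ _ _ ALE; have [W OW WE] := cols_in _ _ _ (esym ALE).
have z_le : tau v (normc z) <= tau v (a p).
  have BAB : invmx B *m A *m B = a p *: ((a p)^-1 *: (D *m U)).
    by rewrite -mulmxA UE -mulmxA mulKmx // scalerA divff // scale1r.
  have ON : intmx O ((a p)^-1 *: (D *m U)).
    move=> i j; rewrite mxE /D mul_diag_mx !mxE mulrA [_ * a i]mulrC.
    by apply: (convex_subringM O_ring); [exact: Odiv|exact: OU].
  exact: (tau_eigenvalue_le ON BAB (a_neq0 p) z0 (eigenvalue_conj BU Az)).
have w_le : tau v (normc w^-1) <= tau v (a q)^-1.
  have BAB : invmx B *m invmx A *m B =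
      (a q)^-1 *: (a q *: (W *m diag_mx (\row_i (a i)^-1))).
    rewrite scalerA mulVf // scale1r -mulmxA.
    have DV : D *m diag_mx (\row_i (a i)^-1) = 1%:M.
      apply/matrixP => i j; rewrite mul_diag_mx !mxE.
      by case: eqP => [->|_]; rewrite ?mulr1n ?mulr0n ?mulr0 // divff.
    have -> : invmx A *m B = B *m (W *m diag_mx (\row_i (a i)^-1)).
      by rewrite -[LHS]mulmx1 -DV -mulmxA (mulmxA B D) WE -!mulmxA mulKmx.
    by rewrite mulKmx.
  have ON : intmx O (a q *: (W *m diag_mx (\row_i (a i)^-1))).
    move=> i j; rewrite mxE mul_mx_diag !mxE mulrCA.
    by apply: (convex_subringM O_ring); [exact: OW|exact: Odiv].
  have aq0 : (a q)^-1 != 0 by rewrite invr_eq0.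
  have wV0 : w^-1 != 0 by rewrite invr_eq0.
  exact: (tau_eigenvalue_le ON BAB aq0 wV0 (eigenvalue_conj BU AVw)).
move: w_le; rewrite normcV !(tauV v_val) ?normc_neq0 // lerN2 => w_le.
by apply: le_trans (spread_ge a p q); exact: lerB.
Qed.

(** Since a_i b_i lies in A L, stability under [A / c] puts (a_i / c) b_i in L, so a_i / c is
    integral. Since d A^-1 b_i lies in L, d b_i lies in A L, so d / a_i is integral. *)
Lemma spread_le_stable (c d : F) : c != 0 -> d != 0 ->
  (forall x, L x -> L (c^-1 *: A *m x)) ->
  (forall x, L x -> L (d *: invmx A *m x)) -> spread a <= tau v c - tau v d.
Proof.
move=> c0 d0 Lc Ld.
have Lcol i : L (B *m delta_mx i 0).
  by rewrite LE; exists (delta_mx i 0) => //; exact: intmx_delta.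
have LAD i : lattice_of O (A *m B) (B *m D *m delta_mx i 0).
  by rewrite ALE; exists (delta_mx i 0) => //; exact: intmx_delta.
apply: spread_le => i.
  have [u Ou uE] := LAD i.
  have : L (B *m u) by rewrite LE; exists u.
  move=> /Lc; rewrite -scalemxAl mulmxA uE LE => -[w Ow].
  rewrite -!mulmxA scalemxAr => /(congr1 (mulmx (invmx B))); rewrite !mulKmx //.
  move=> /matrixP/(_ i 0); rewrite mxE /D mul_diag_mx !mxE !eqxx mulr1 => wE.
  by apply: val_ring_tau_le => //; rewrite mulrC -wE.
have := Ld _ (Lcol i); rewrite LE => -[u Ou /(congr1 (mulmx A))].
rewrite -scalemxAl -scalemxAr mulKVmx // => uE.
have : lattice_of O (B *m D) (A *m (B *m u)) by rewrite -ALE; exists u => //; rewrite mulmxA.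
rewrite uE => -[w Ow].
rewrite -!mulmxA scalemxAr => /(congr1 (mulmx (invmx B))); rewrite !mulKmx //.
move=> /matrixP/(_ i 0); rewrite /D mul_diag_mx !mxE !eqxx mulr1 => wE.
apply: val_ring_tau_le => //.
have -> : d / a i = w i 0 by rewrite -wE mulrC mulKf.
exact: Ow.
Qed.

End AdaptedBasis.

(** * From lattices to points of FP^n *)

Lemma homothety_class_self (L : set V) : homothety_class L L.
Proof.
exists 1; first exact: oner_neq0.
by rewrite eqEsubset; split=> [_ [x Lx <-]|x Lx]; [rewrite scale1r|exists x; rewrite ?scale1r].
Qed.

(** An adapted basis shows that some value exists, so the one selected by [xget] comes from actual
    lifts. *)
Lemma FP_distP (A : 'M[F]_n.+1) (L : set V) : A \in unitmx -> maximal_lattice v L ->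
  FP_dist_value v (homothety_class L) (FP_act A (homothety_class L))
    (FP_dist v (homothety_class L) (FP_act A (homothety_class L))).
Proof.
move=> AU Lmax; apply: xgetPex.
have [b [a [a0 Lb ALb]]] := adapted_basis v_val v_convex AU Lmax.
exists (spread a), L, [set A *m u | u in L], b, a; split => //; split.
  exact: homothety_class_self.
by exists L => //; exact: homothety_class_self.
Qed.

(** Lifts y L0 and A (z L0) are L = y L0 and its image under (z / y) A, so every choice of lifts
    reduces to a single lattice and a rescaled matrix. *)
Lemma FP_dist_value_lifts (A : 'M[F]_n.+1) (L0 : set V) (r : R) :
  FP_dist_value v (homothety_class L0) (FP_act A (homothety_class L0)) r ->
  exists (y z : F) b a, let L := [set y *: x | x in L0] in
    [/\ z != 0, (forall i, a i != 0), Obasis v L b,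
      Obasis v [set (z *: A) *m u | u in L] (fun i => a i *: b i) & r = spread a].
Proof.
move=> [_ [_ [b [a [[[y y0 <-] [_ [z z0 <-] <-]] a0 Lb L'b ->]]]]].
exists y, (z / y), b, a; split => //; first by rewrite mulf_neq0 ?invr_eq0.
suff <- : [set A *m u | u in [set z *: x | x in L0]] =
    [set z / y *: A *m u | u in [set y *: x | x in L0]] by [].
rewrite eqEsubset; split => _ [_ [x Lx <-] <-].
  exists (y *: x); first by exists x.
  by rewrite -scalemxAl -!scalemxAr scalerA divfK.
exists (z *: x); first by exists x.
by rewrite -scalemxAl -!scalemxAr scalerA divfK.
Qed.

Lemma FP_dist_ge_eigenvalues (A : 'M[F]_n.+1) (x : set (set V)) (z w : F[i]) :
  A \in unitmx -> FP v n x ->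
  eigenvalue (map_mx toC A) z -> eigenvalue (map_mx toC A) w ->
  tau v (normc z) - tau v (normc w) <= FP_dist v x (FP_act A x).
Proof.
move=> AU [L Lmax <-] Az Aw.
have [y [t [b [a [t0 a0 Lb ALb ->]]]]] := FP_dist_value_lifts (FP_distP AU Lmax).
have tAU : t *: A \in unitmx by rewrite unitmxZ ?unitfE.
have := spread_ge_eigenvalues tAU a0 Lb ALb (eigenvalue_scale t Az) (eigenvalue_scale t Aw).
have [z0 _] := eigenvalue_inv AU Az; have [w0 _] := eigenvalue_inv AU Aw.
(* Rescaling by [t] adds [tau v t] to both terms, which cancels. *)
rewrite !normcM !normc_real !(tauM v_val) ?normr_eq0 ?normc_neq0 //.
by rewrite [X in X - _]addrC addrKA.
Qed.

Lemma FP_dist_le_stable (A : 'M[F]_n.+1) (L : set V) (c d : F) :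
  A \in unitmx -> maximal_lattice v L -> c != 0 -> d != 0 ->
  (forall x, L x -> L (c^-1 *: A *m x)) ->
  (forall x, L x -> L (d *: invmx A *m x)) ->
  FP_dist v (homothety_class L) (FP_act A (homothety_class L)) <= tau v c - tau v d.
Proof.
move=> AU Lmax c0 d0 Lc Ld.
have [y [t [b [a [t0 a0 Lb ALb ->]]]]] := FP_dist_value_lifts (FP_distP AU Lmax).
have tAU : t *: A \in unitmx by rewrite unitmxZ ?unitfE.
have -> : tau v c - tau v d = tau v (t * c) - tau v (t * d).
  by rewrite !(tauM v_val) // [X in _ = X - _]addrC addrKA.
apply: (spread_le_stable tAU a0 Lb ALb); rewrite ?mulf_neq0 //.
  (* The factor [t] cancels in (t c)^-1 (t A) and (t d) (t A)^-1, so stability of L passes to y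
     L. *)
  move=> _ [x Lx <-]; exists (c^-1 *: A *m x); first exact: Lc.
  by rewrite scalerA invfM mulrAC mulVf // mul1r scalemxAr.
move=> _ [x Lx <-]; exists (d *: invmx A *m x); first exact: Ld.
by rewrite invmxZ ?unitfE // scalerA mulrAC divff // mul1r scalemxAr.
Qed.

End Distance.

Unset Implicit Arguments.

Theorem proposition6p3 (R : realType) (F : rcfType)
  (iota : {rmorphism R -> F})
  (F_nonarch : ~ Num.archimedean_axiom F)
  (F_rank : finite_rank F)
  (v : F -> R) (v_val : real_valuation v)
  (v_surj : forall r : R, exists2 x : F, x != 0 & v x = r)
  (v_convex : convex_set_in (val_ring v))
  (n : nat) (A : 'M[F]_n.+1) (A_GL : A \in unitmx)
  (lambda : 'I_n.+1 -> F[i])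
  (lambda_eigen : char_poly (map_mx (real_complex F) A)
                  = \prod_(i < n.+1) ('X - (lambda i)%:P))
  (lambda_sorted : forall i j : 'I_n.+1, (i <= j)%N ->
     ComplexField.Normc.normc (lambda j) <= ComplexField.Normc.normc (lambda i)) :
  (exists2 x, FP v n x &
     FP_dist v x (FP_act A x) = translation_length v A) /\
  translation_length v A
    = tau v (ComplexField.Normc.normc (lambda ord0 / lambda ord_max)).
Proof.
have O_ring := val_ring_convex_subring v_val v_convex.
have lambdaP i : eigenvalue (map_mx (real_complex F) A) (lambda i).
  rewrite eigenvalue_root_char lambda_eigen rootE horner_prod.
  by rewrite (bigD1 i) //= hornerXsubC subrr mul0r.
have lambda0 i : lambda i != 0 by case: (eigenvalue_inv A_GL (lambdaP i)).
have norm_gt0 i : 0 < ComplexField.Normc.normc (lambda i).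
  by rewrite lt_neqAle normc_ge0 eq_sym normc_neq0.
set c := ComplexField.Normc.normc (lambda ord0).
set d := ComplexField.Normc.normc (lambda ord_max).
have c0 : c != 0 by rewrite gt_eqF ?norm_gt0.
have d0 : d != 0 by rewrite gt_eqF ?norm_gt0.
have -> : tau v (ComplexField.Normc.normc (lambda ord0 / lambda ord_max)) =
    tau v c - tau v d.
  by rewrite ComplexField.Normc.normcM ComplexField.Normc.normcV (tau_div v_val).
have dist_ge x : FP v n x -> tau v c - tau v d <= FP_dist v x (FP_act A x).
  by move=> xFP; exact: FP_dist_ge_eigenvalues.
have lambda_bound i : d <= ComplexField.Normc.normc (lambda i) <= c.
  by rewrite !lambda_sorted ?leq_ord.
have [m [W [Wfree Wc Wd]]] :=
  invariant_lattice O_ring A_GL lambda_eigen (norm_gt0 ord_max) lambda_bound.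
pose L := lattice_of (val_ring v) W.
have Lmax : maximal_lattice v L by apply/maximal_latticeP; exists m, W.
have LFP : FP v n (homothety_class L) by exists L.
(* The stable lattice attains the lower bound that the extreme eigenvalues impose at every point. *)
have LE : FP_dist v (homothety_class L) (FP_act A (homothety_class L)) =
    tau v c - tau v d.
  by apply/eqP; rewrite eq_le dist_ge // andbT FP_dist_le_stable.
suff lE : translation_length v A = tau v c - tau v d.
  by split => //; exists (homothety_class L); rewrite // lE.
rewrite /translation_length; apply/eqP; rewrite eq_le; apply/andP; split.
  rewrite -LE; apply: ge_inf; last by exists (homothety_class L).
  by exists (tau v c - tau v d) => _ [x xFP <-]; exact: dist_ge.
apply: lb_le_inf; first by exists (tau v c - tau v d), (homothety_class L).
by move=> _ [x xFP <-]; exact: dist_ge.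
Qed.
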